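(* Let $k \ge 1$ and let $M$ be a finite multiset of integers with underlying set $U = \{x_1, \ldots, x_k\}$, where $1 < x_1 < \cdots < x_k$. Then the multiset $L = M \cup \{1^s\}$ is realizable for every integer $s \geq 3x_k - 5 + \sum_{i=1}^{k} x_i$.
   Context: Multisets: exponents denote multiplicity, so $\{1^s\}$ is the multiset consisting of $s$ copies of $1$. The union $\cup$ of multisets adds multiplicities. The underlying set of a multiset is the set of its distinct elements. Realizations: $K_v$ is the complete graph on the vertex set $\{0,1,\ldots,v-1\}$. The length of the edge between $x$ and $y$ in $K_v$ is $\ell(x,y)=\min(|x-y|,\,v-|x-y|)$. A multiset $L$ of size $v-1$ is realizable if there is a Hamiltonian path $[h_1,\ldots,h_v]$ in $K_v$ such that the multiset of edge-lengths $\{\ell(h_i,h_{i+1}) : 1\le i\le v-1\}$ equals $L$ (here $v=|L|+1$). *)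

(* Defs.v *)
From mathcomp Require Import all_boot all_algebra.
From mathcomp Require Export finmap multiset.

Set Implicit Arguments.
Unset Strict Implicit.
Unset Printing Implicit Defensive.

Definition complete_graph (V : eqType) : rel V := [rel x y | x != y].

(* The path is given by its whole sequence of vertices. *)
Definition hamiltonian_path (V : finType) (e : rel V) (h : seq V) : bool :=
  [&& sorted e h, uniq h & [forall x, x \in h]].

(* `|x - y| is the distance |x - y| in nat; the outer subtraction never
   truncates, since x and y are both less than v. *)
Definition edge_length (v : nat) (x y : 'I_v) : nat :=
  minn `|x - y| (v - `|x - y|).

Definition edge_lengths (v : nat) (h : seq 'I_v) : {mset nat}%mset :=
  seq_mset [seq edge_length p.1 p.2 | p <- zip h (behead h)].

(* size L counts multiplicities. *)
Definition realizable (L : {mset nat}%mset) : Prop :=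
  let v := (size L).+1 in
  exists h : seq 'I_v,
    hamiltonian_path (@complete_graph 'I_v) h /\ edge_lengths h = L.

(* Main.v *)
Require Import Defs.
From mathcomp Require Import all_boot all_algebra.
From mathcomp Require Import finmap multiset.
From mathcomp Require Import zify.

(** The path built here is linear: a permutation h of 0, ..., v-1 whose
    consecutive differences |a - b| form L.  Since v is at least twice the
    largest length, these differences are the edge lengths in K_v.

    Call c the multiplicity function of M, let N = x_k, and write each
    multiplicity as c d = q * d + r with r < d.  The path grows upwards from the
    single vertex 0, by four devices.

    - [spiral_of_distinct_lengths]: a path on 0, ..., v-1 ending at v-1 can be
      reflected, so that it ends at 0, and then jump to v: this adds one edge of
      length v.  Doing so for chosen values of v, and stepping by 1 for the
      others, adds any set of distinct lengths at most N, with at most N ones.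
      It serves to take one copy of each d whose r is even and nonzero, so that
      the rest of r is odd or zero.

    - [walk_up]: stepping by 1 creates a run of consecutive edges at the top.

    - [grow_period]: if the edge (a, a+1) is in the path, where a + y and a+y+1
      are the two new top vertices, replacing it by a, a+y, a+y+1, a+1 adds two
      copies of y and no 1, and leaves the edge (a+y, a+y+1) at the top.  When
      the top y vertices are matched by such edges (y even), or matched except
      for the last vertex of the path, which is at the top (y odd), a full round
      adds y copies of y and recreates the same configuration y higher.  As a
      configuration of width w contains those of smaller width, treating the
      lengths in decreasing order, one walk up is enough for all the odd d
      ([grow_all_periods] with p = true) and another one for all the even d.
      This places the q * d copies of each d; the two walks need at most
      (N-1) + (N-2) ones.

    - [add_odd_leftover]: an edge (v-2, v-1) at the top may be replaced by
      v-2, v+y-2, v+y-3, ..., v, v-1, which adds one copy of y and only y-2 ones.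
      It creates a run on y vertices, on which the replacement of [grow_period]
      can be done up to y/2 times; this places any odd number of copies of y
      less than y, and there is again an edge at the top for the next length.

    The number of ones spent is at most N + (N-1) + (N-2) + the sum of the
    x_i - 2, which is at most 3N - 5 + the sum of the x_i because k >= 1; the ones
    in excess are spent in the second walk. *)

Set Implicit Arguments.
Unset Strict Implicit.
Unset Printing Implicit Defensive.

(** * Edges of a path and their lengths *)

Definition edges (T : Type) (h : seq T) : seq (T * T) := zip h (behead h).

Definition diffs (h : seq nat) : seq nat := [seq `|p.1 - p.2| | p : nat * nat <- edges h].

(** The orientation is forgotten because the surgeries below replace an edge in
    whichever direction the path traverses it. *)
Definition link (h : seq nat) (a : nat) : bool :=
  ((a, a.+1) \in edges h) || ((a.+1, a) \in edges h).

Definition realizes (h : seq nat) (v : nat) (c : nat -> nat) : Prop :=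
  perm_eq h (iota 0 v) /\ (forall d, count_mem d (diffs h) = c d).

(** Two vertices (e, e+1) are matched.  For p = false the matching is
    (v-2, v-1), (v-4, v-3), ...; for p = true it is (v-3, v-2), (v-5, v-4), ...,
    leaving out v-1, which is meant to be the last vertex of the path. *)
Definition aligned (p : bool) (h : seq nat) (v w : nat) : Prop :=
  forall e, v - w <= e -> e.+1 < v -> odd (v - e) = p -> link h e.

Lemma edges_cat (T : Type) (s1 s2 : seq T) a :
  edges (s1 ++ a :: s2) = edges (rcons s1 a) ++ edges (a :: s2).
Proof.
rewrite /edges; elim: s1 => [|b s1 IH] //=.
by case: s1 IH => [|b' s1] //= ->.
Qed.

Lemma edges_rcons (T : Type) (x : T) (h : seq T) (a : T) :
  0 < size h -> edges (rcons h a) = rcons (edges h) (last x h, a).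
Proof.
case/lastP: h => // s b _.
by rewrite -cats1 cat_rcons edges_cat last_rcons /= cats1.
Qed.

Lemma edges_map (S T : Type) (f : S -> T) h :
  edges (map f h) = [seq (f p.1, f p.2) | p <- edges h].
Proof. by rewrite /edges; elim: h => // a [|b h] //= ->. Qed.

Lemma edges_rev (T : Type) (h : seq T) :
  edges (rev h) = rev [seq (p.2, p.1) | p <- edges h].
Proof.
elim: h => [|a [|b h] IH] //.
have -> : edges [:: a, b & h] = (a, b) :: edges (b :: h) by [].
rewrite rev_cons (@edges_rcons _ a) ?size_rev // IH map_cons !rev_cons.
by rewrite last_rcons.
Qed.

Lemma mem_edges (T : eqType) (h : seq T) p :
  p \in edges h -> (p.1 \in h) && (p.2 \in h).
Proof.
elim: h => [|a [|b h] IH] //=; rewrite inE => /orP[/eqP->|/IH].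
  by rewrite !inE !eqxx orbT.
by rewrite inE => /andP[-> H]; rewrite in_cons H !orbT.
Qed.

Lemma edges_split (T : eqType) (h : seq T) a b :
  (a, b) \in edges h -> exists s1 s2, h = s1 ++ a :: b :: s2.
Proof.
elim: h => [|c [|d h] IH] //; rewrite [edges _]/edges /= inE => /orP[/eqP[-> ->]|/IH].
  by exists [::], h.
by move=> [s1 [s2 ->]]; exists (c :: s1), s2.
Qed.

Lemma diffs_rev h : diffs (rev h) = rev (diffs h).
Proof.
rewrite /diffs edges_rev map_rev -map_comp; congr rev.
by apply: eq_map => p /=; rewrite distnC.
Qed.

Lemma link_rev h a : link (rev h) a = link h a.
Proof.
rewrite /link edges_rev !mem_rev orbC.
have P (p : nat * nat) : (p \in [seq (q.2, q.1) | q <- edges h]) = ((p.2, p.1) \in edges h).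
  have inj : injective (fun q : nat * nat => (q.2, q.1)) by move=> [? ?] [? ?] [-> ->].
  by rewrite -[LHS](mem_map inj) -map_comp map_id_in //; case.
by rewrite !P.
Qed.

(** * Local modifications of a path *)

(** The only surgery inside a path, used for both [lift_pairs] and
    [detour_above_top].  The removed edge, of length 1, is counted on the left to
    avoid a subtraction. *)
Lemma splice h a w : link h a ->
  exists h', [/\ perm_eq h' (h ++ w),
    forall d, count_mem d (diffs h') + (d == 1) =
              count_mem d (diffs h) + count_mem d (diffs (a :: rcons w a.+1)),
    forall e, e != a -> link h e -> link h' e,
    forall e, link (a :: rcons w a.+1) e -> link h' e
  & last 0 h' = last 0 h].
Proof.
(* One of the two orientations; the other one is obtained with rev w. *)
have key (b b' : nat) (u s1 s2 : seq nat) :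
    `|b - b'| = 1 ->
    (forall e, e != a -> (e, e.+1) != (b, b') /\ (e.+1, e) != (b, b')) ->
  let h := s1 ++ b :: b' :: s2 in
  let h' := s1 ++ b :: u ++ b' :: s2 in
  [/\ perm_eq h' (h ++ u),
    forall d, count_mem d (diffs h') + (d == 1) =
              count_mem d (diffs h) + count_mem d (diffs (b :: rcons u b')),
    forall e, e != a -> link h e -> link h' e,
    forall e, link (b :: rcons u b') e -> link h' e
  & last 0 h' = last 0 h].
  move=> Hd Hn /=.
  have E1 : edges (s1 ++ b :: b' :: s2) =
     edges (rcons s1 b) ++ (b, b') :: edges (b' :: s2) by rewrite edges_cat.
  have E2 : edges (s1 ++ b :: u ++ b' :: s2) =
     edges (rcons s1 b) ++ edges (b :: rcons u b') ++ edges (b' :: s2).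
    by rewrite edges_cat -cat_cons edges_cat.
  split.
  - rewrite -catA perm_cat2l /= perm_cons.
    by rewrite -cat_cons perm_catC.
  - move=> d; rewrite /diffs E1 E2 !map_cat !count_cat /= Hd (eq_sym 1); lia.
  - move=> e /Hn[H1 H2]; rewrite /link E1 E2 !mem_cat !inE (negbTE H1) (negbTE H2) /=.
    by case/orP=> /orP[] ->; rewrite ?orbT.
  - by move=> e; rewrite /link E2 !mem_cat => /orP[] ->; rewrite ?orbT.
  - by rewrite !last_cat /= last_cat.
case/orP=> /edges_split[s1 [s2 ->]].
  have [||H1 H2 H3 H4 H5] := key a a.+1 w s1 s2; try lia.
    by move=> e ne; rewrite !xpair_eqE; lia.
  by exists (s1 ++ a :: w ++ a.+1 :: s2).
have [||H1 H2 H3 H4 H5] := key a.+1 a (rev w) s1 s2; try lia.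
  by move=> e ne; rewrite !xpair_eqE; lia.
have R : a.+1 :: rcons (rev w) a = rev (a :: rcons w a.+1).
  by rewrite rev_cons rev_rcons.
exists (s1 ++ a.+1 :: rev w ++ a :: s2); split=> //.
- by apply: perm_trans H1 _; rewrite perm_cat2l perm_rev.
- by move=> d; rewrite H2 R diffs_rev count_rev.
- by move=> e He; apply: H4; rewrite R link_rev.
Qed.

(** Each of the n disjoint edges (a, a+1), with a = v - y + 2j, is
    rerouted through the new vertices a+y, a+y+1.  The last clause, on the edges
    that are left intact, makes the induction work, and yields the top edge
    when n = 0 in [add_odd_leftover]. *)
Lemma lift_pairs h v c y n : realizes h v c -> n.*2 <= y -> y <= v ->
    (forall j, j < n -> link h (v - y + j.*2)) ->
  exists h', [/\ realizes h' (v + n.*2) (fun d => c d + (d == y) * n.*2),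
    last 0 h' = last 0 h,
    forall j, j < n -> link h' (v + j.*2)
  & forall e, v - y + n.*2 <= e -> link h e -> link h' e].
Proof.
move=> [Hp Hc] Hny Hyv; elim: n Hny => [|n IH] Hny Hl.
  exists h; split=> //.
  by rewrite double0 addn0; split=> // d; rewrite Hc muln0 addn0.
have [|j Hj|h1 [[P1 C1] L1 K1 O1]] := IH; [lia|by apply: Hl; lia|].
set a := v - y + n.*2.
have La : link h1 a by apply: O1 => //; apply: Hl.
have [h2 [P2 C2 O2 N2 L2]] := splice [:: a + y; (a + y).+1] La.
exists h2; split; last 1 first.
- by move=> e He /O1 le; apply: O2; [lia|apply: le; lia].
- split.
    apply: perm_trans P2 _; rewrite doubleS -addn2 addnA iotaD.
    have -> : iota (0 + (v + n.*2)) 2 = [:: a + y; (a + y).+1].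
      by rewrite /=; congr [:: _; _.+1]; rewrite /a; lia.
    by rewrite perm_cat2r.
  move=> d; move: (C2 d); rewrite C1 /diffs /edges /=.
  have -> : `|a - (a + y)| = y by lia.
  have -> : `|a + y - (a + y).+1| = 1 by lia.
  have -> : `|(a + y).+1 - a.+1| = y by lia.
  rewrite ![_ == d]eq_sym; lia.
- by rewrite L2.
- move=> j; rewrite ltnS leq_eqVlt => /orP[/eqP->|Hj].
    apply: N2; rewrite (_ : v + n.*2 = a + y); last by rewrite /a; lia.
    by rewrite /link /edges /= !inE eqxx !orbT.
  by apply: O2; [rewrite /a; lia|apply: K1].
Qed.

(** * Extending a path at its last vertex *)

Lemma realizes_ext h v c c' : realizes h v c -> (forall d, c d = c' d) -> realizes h v c'.
Proof. by move=> [Hp Hc] E; split=> // d; rewrite Hc. Qed.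

Lemma realizes_size h v c : realizes h v c -> size h = v.
Proof. by move=> [/perm_size]; rewrite size_iota. Qed.

Lemma realizes_rcons h v c : realizes h v c -> 0 < v ->
  realizes (rcons h v) v.+1 (fun d => c d + (d == `|last 0 h - v|)).
Proof.
move=> H v0; have Hs := realizes_size H; case: H => Hp Hc; split.
  by rewrite -cats1 -addn1 iotaD perm_cat2r.
move=> d; rewrite /diffs (@edges_rcons _ 0) ?Hs // map_rcons -cats1 count_cat.
by rewrite /= Hc addn0 eq_sym.
Qed.

Lemma link_rcons h a e : link h e -> link (rcons h a) e.
Proof.
case/lastP: h => // s b; rewrite /link -[rcons (rcons s b) a]cats1 cat_rcons edges_cat !mem_cat.
by case/orP=> ->; rewrite ?orbT.
Qed.

(** Reflection keeps the lengths and moves the end of the path to 0, at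
    distance v from the next free vertex. *)
Lemma reflect_and_jump h v c : realizes h v c -> 0 < v -> last 0 h = v.-1 ->
  exists h', realizes h' v.+1 (fun d => c d + (d == v)) /\ last 0 h' = v.
Proof.
move=> H v0 Hl; have Hs := realizes_size H; case: H => Hp Hc.
pose f x := v.-1 - x.
have lt x : x \in h -> x < v by rewrite (perm_mem Hp) mem_iota.
have Hr : realizes (map f h) v c.
  have fK : {in h, cancel f f} by move=> x /lt; rewrite /f; lia.
  split.
    apply: uniq_perm; rewrite ?iota_uniq ?map_inj_in_uniq //.
    - by rewrite (perm_uniq Hp) iota_uniq.
    - exact: can_in_inj fK.
    move=> x; rewrite mem_iota add0n; apply/mapP/idP => [[z /lt]|Hx]; first by rewrite /f; lia.
    exists (f x); last by rewrite /f; lia.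
    by rewrite (perm_mem Hp) mem_iota /f; lia.
  move=> d; rewrite -Hc /diffs edges_map -map_comp; congr (count_mem d _).
  apply/eq_in_map => -[a b] /mem_edges /= /andP[/lt Ha /lt Hb].
  by rewrite /f; lia.
exists (rcons (map f h) v); rewrite last_rcons; split=> //.
apply: realizes_ext (realizes_rcons Hr v0) _ => d.
have -> : last 0 (map f h) = 0.
  have -> : last 0 (map f h) = last (f (v.-1)) (map f h).
    by case: h Hs {Hp Hc Hl lt Hr} => //= E; lia.
  by rewrite last_map; case: h Hs Hl {Hp Hc lt Hr} => [|? ?] /=; rewrite /f; lia.
by congr (_ + (_ == _)); lia.
Qed.

(** The n + 1 vertices of the walk carry edges of both parities, hence the
    alignment for every p. *)
Lemma walk_up h v c n : realizes h v c -> 0 < v -> last 0 h = v.-1 ->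
  exists h', [/\ realizes h' (v + n) (fun d => c d + (d == 1) * n),
    last 0 h' = (v + n).-1
  & forall p, aligned p h' (v + n) n.+1].
Proof.
move=> H v0 Hl; elim: n => [|n [h' [H1 L1 A1]]].
  exists h; rewrite addn0; split=> //.
    by apply: realizes_ext H _ => d; rewrite muln0 addn0.
  by move=> p e; lia.
exists (rcons h' (v + n)); rewrite addnS last_rcons; split=> //.
  apply: realizes_ext (realizes_rcons H1 _) _ => [|d]; first lia.
  rewrite L1 (_ : `|(v + n).-1 - (v + n)| = 1); lia.
move=> p e He Hv _; case: (ltnP e.+1 (v + n)) => He'.
  by apply: link_rcons; apply: (A1 (odd (v + n - e))) => //; lia.
have -> : e = last 0 h' by lia.
have S := realizes_size H1.
by rewrite /link (@edges_rcons _ 0) ?S ?mem_rcons ?inE ?L1; [rewrite (_ : _.-1.+1 = v + n) ?eqxx //; lia|lia].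
Qed.

(** Without the reflections, this is a path that spirals outwards from an
    inner vertex: a jump of length d occurs when the visited interval has size d,
    so that each length is available exactly once. *)
Lemma spiral_of_distinct_lengths (Y : pred nat) n : exists h t, [/\ t <= n,
    realizes h n.+1 (fun d => (1 < d <= n) && Y d + (d == 1) * t)
  & last 0 h = n].
Proof.
elim: n => [|n [h [t [tn H L]]]].
  exists [:: 0], 0; split=> //; split=> // d; rewrite muln0 addn0 /=; lia.
case: (boolP ((1 < n.+1) && Y n.+1)) => [/andP[n1 Yn]|nY].
  have [h' [H' L']] := reflect_and_jump H isT L.
  exists h', t; split=> //; first lia.
  apply: realizes_ext H' _ => d; case: (eqVneq d n.+1) => [->|nd]; first by rewrite Yn; lia.
  by rewrite addn0; congr (nat_of_bool (_ && _) + _); lia.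
have [h' [H' L' _]] := walk_up 1 H isT L.
exists h', t.+1; split=> //; last by rewrite L' addn1.
move: H'; rewrite addn1 => H'; apply: realizes_ext H' _ => d.
rewrite -addnA -mulnDr addn1; congr (nat_of_bool _ + _).
case: (eqVneq d n.+1) nY => [-> /negbTE nY|nd _]; last by congr (_ && _); lia.
by rewrite ltnn andbF leqnn andbT nY.
Qed.

(** * Adding full periods: y copies of y *)

(** For odd y, the vertex v - 1 that is left out of the matching is the
    end of the path: after the other y - 1 vertices have been lifted, the step
    from v - 1 to v + y - 1 completes the period and brings the end of the path
    back to the top. *)
Lemma grow_period p h v c y : odd y = p -> 1 < y -> y <= v -> realizes h v c ->
    (p -> last 0 h = v.-1) -> aligned p h v y ->
  exists h', [/\ realizes h' (v + y) (fun d => c d + (d == y) * y),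
    p -> last 0 h' = (v + y).-1 & aligned p h' (v + y) y].
Proof.
move=> Hy y1 yv H Hl A.
have Ey : y = p + y./2.*2 by rewrite -Hy odd_double_half.
have [||h1 [H1 L1 K1 _]] := lift_pairs H (n := y./2) _ yv; first by lia.
  by move=> j Hj; apply: A; lia.
have newlinks v' h' : v' = v + y -> (forall j, j < y./2 -> link h' (v + j.*2)) -> aligned p h' v' y.
  move=> -> K e He Hv Ho; have -> : e = v + (e - v)./2.*2 by lia.
  by apply: K; lia.
case: p Hy Ey Hl A newlinks => Hy Ey Hl A newlinks.
  exists (rcons h1 (v + y./2.*2)); rewrite last_rcons; split=> [|_|]; last first.
  - by apply: newlinks => // j Hj; apply/link_rcons/K1.
  - lia.
  rewrite (_ : v + y = (v + y./2.*2).+1); last lia.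
  apply: realizes_ext (realizes_rcons H1 _) _ => [|d]; first lia.
  rewrite L1 Hl // (_ : `|v.-1 - (v + y./2.*2)| = y); last lia.
  by rewrite -addnA -mulnSr; congr (_ + _ * _); lia.
exists h1; split=> //; last by apply: newlinks.
have E : y./2.*2 = y by lia.
by move: H1; rewrite E.
Qed.

Lemma grow_periods p h v c y q : odd y = p -> 1 < y -> y <= v -> realizes h v c ->
    (p -> last 0 h = v.-1) -> aligned p h v y ->
  exists h' v', [/\ v <= v', realizes h' v' (fun d => c d + (d == y) * (q * y)),
    p -> last 0 h' = v'.-1 & aligned p h' v' y].
Proof.
move=> Hy y1 yv H Hl A; elim: q => [|q [h1 [v1 [v1v H1 L1 A1]]]].
  exists h, v; split=> //.
  by apply: realizes_ext H _ => d; rewrite mul0n muln0 addn0.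
have [|h2 [H2 L2 A2]] := grow_period Hy y1 _ H1 L1 A1; first lia.
exists h2, (v1 + y); split=> //; first lia.
by apply: realizes_ext H2 _ => d; rewrite -addnA -mulnDr mulSnr.
Qed.

Lemma alignedW p h v w w' : w' <= w -> aligned p h v w -> aligned p h v w'.
Proof. by move=> Hw A e He; apply: A; lia. Qed.

(** The lowest of the w top vertices is then matched downwards, to a vertex
    outside of the window. *)
Lemma alignedS p h v w : odd w = ~~ p -> aligned p h v w.-1 -> aligned p h v w.
Proof.
move=> Hw A e He Hv Ho; apply: A => //; case: p Hw Ho; lia.
Qed.

(** Lengths are treated from w downwards, since the period of y only
    guarantees an alignment of width y. *)
Lemma grow_all_periods (p : bool) (q : nat -> nat) w : 1 < w -> forall h v c, w <= v -> realizes h v c ->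
    (p -> last 0 h = v.-1) -> aligned p h v w ->
  exists h' v', [/\ v <= v',
    realizes h' v' (fun d => c d + (1 < d <= w) * (odd d == p) * (q d * d)),
    p -> last 0 h' = v'.-1 & aligned p h' v' 2].
Proof.
elim: w => // w IH w1 h v c wv H Hl A.
have [h1 [v1 [v1v H1 L1 A1]]] : exists h1 v1, [/\ v <= v1,
    realizes h1 v1 (fun d => c d + (d == w.+1) * (odd d == p) * (q d * d)),
    p -> last 0 h1 = v1.-1 & aligned p h1 v1 w.+1].
  case: (odd w.+1 =P p) => [E|/eqP E].
    have [h1 [v1 [v1v H1 L1 A1]]] := grow_periods (q w.+1) E w1 wv H Hl A.
    exists h1, v1; split=> //; apply: realizes_ext H1 _ => d.
    by case: eqP => [->|]; rewrite ?E ?eqxx.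
  exists h, v; split=> //; apply: realizes_ext H _ => d.
  by case: eqP => [->|]; rewrite ?(negbTE E) !mul0n ?addn0.
have [w2|w2] := leqP w 1.
  exists h1, v1; split=> //; last by apply: alignedW A1; lia.
  apply: realizes_ext H1 _ => d; congr (_ + nat_of_bool _ * _ * _); lia.
have [||h2 [v2 [v2v H2 L2 A2]]] := IH w2 h1 v1 _ _ H1 L1; first lia.
  by apply: alignedW A1; lia.
exists h2, v2; split=> //; first exact: leq_trans v1v v2v.
apply: realizes_ext H2 _ => d; rewrite -addnA -!mulnDl; congr (_ + _ * _ * _); lia.
Qed.

(** * Adding an odd number of copies, less than a period *)

Lemma edges_iota m n : edges (iota m n) = [seq (i, i.+1) | i <- iota m n.-1].
Proof. by rewrite /edges; elim: n m => // -[|n] // IH m; rewrite /= -IH. Qed.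

Lemma diffs_iota m n : diffs (iota m n) = nseq n.-1 1.
Proof.
rewrite /diffs edges_iota -map_comp -[n.-1 in RHS](size_iota m).
by elim: (iota _ _) => //= i s ->; congr (_ :: _); lia.
Qed.

Lemma link_iota m n e : m <= e -> e.+1 < m + n -> link (iota m n) e.
Proof.
move=> me en; rewrite /link edges_iota.
by rewrite (map_f (fun i => (i, i.+1))) // mem_iota; lia.
Qed.

(** The detour goes up by y and comes back down by ones.  It has y - 1 ones,
    one of which replaces the removed edge. *)
Lemma detour_above_top h v c y : 1 < y -> 1 < v -> realizes h v c -> link h (v - 2) ->
  exists h', realizes h' (v + y.-1) (fun d => c d + (d == y) + (d == 1) * (y - 2)) /\
    forall e, v.-1 <= e -> e.+1 < v + y.-1 -> link h' e.
Proof.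
move=> y1 v1 [Hp Hc] Hl.
have [h' [P C _ N _]] := splice (rev (iota v y.-1)) Hl.
have E : v - 2 :: rcons (rev (iota v y.-1)) (v - 2).+1 = rev (rcons (iota v.-1 y) (v - 2)).
  rewrite rev_rcons (_ : iota v.-1 y = v.-1 :: iota v y.-1); last first.
    by case: y y1 {C N P} => //= y _; congr (_ :: iota _ _); lia.
  by rewrite rev_cons; congr (_ :: rcons _ _); lia.
have Sy : 0 < size (iota v.-1 y) by rewrite size_iota; lia.
have Ly : last 0 (iota v.-1 y) = v.-1 + y.-1.
  by rewrite -nth_last size_iota nth_iota; lia.
exists h'; split; last first.
  move=> e He Hv; apply: N; rewrite E link_rev; apply: link_rcons.
  by apply: link_iota => //; lia.
split.
  by apply: perm_trans P _; rewrite iotaD perm_cat // perm_rev.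
move=> d; move: (C d); rewrite E diffs_rev count_rev Hc.
rewrite /diffs (@edges_rcons _ 0) // map_rcons -[map _ (edges (iota _ _))]/(diffs _) diffs_iota Ly -cats1 count_cat count_nseq /=.
have -> : `|v.-1 + y.-1 - (v - 2)| = y by lia.
rewrite !(eq_sym d); lia.
Qed.

(** The detour gives one copy of y and a run on y vertices starting at
    v - 1, exactly y below the new top; the other copies come in pairs. *)
Lemma add_odd_leftover h v c y l : 1 < y -> y <= v -> odd l -> l < y ->
    realizes h v c -> link h (v - 2) ->
  exists h' v', [/\ v <= v',
    realizes h' v' (fun d => c d + (d == y) * l + (d == 1) * (y - 2))
  & link h' (v' - 2)].
Proof.
move=> y1 yv Ol ly H Hl.
have [|h1 [H1 N1]] := detour_above_top y1 _ H Hl; first lia.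
have [|||h2 [H2 _ K2 O2]] := lift_pairs H1 (y := y) (n := l./2); [lia|lia| |].
  by move=> j Hj; apply: N1; lia.
exists h2, (v + y.-1 + l./2.*2); split; first lia.
- apply: realizes_ext H2 _ => d.
  have -> : l = l./2.*2.+1 by lia.
  by rewrite /= uphalf_double; case: (d == y); lia.
case El : l./2 => [|n].
  by apply: O2; [rewrite El; lia|apply: N1; lia].
by rewrite (_ : _ - 2 = v + y.-1 + n.*2); [apply: K2; lia|lia].
Qed.

Lemma add_odd_leftovers (l : nat -> nat) n h v c : n <= v ->
    (forall d, 1 < d <= n -> 0 < l d -> odd (l d) /\ l d < d) ->
    realizes h v c -> link h (v - 2) ->
  exists h' v', realizes h' v' (fun d => c d + (1 < d <= n) * l d +
      (d == 1) * \sum_(2 <= i < n.+1 | 0 < l i) (i - 2)).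
Proof.
move=> nv Hl0 H Hl.
suff [h' [v' [_ H' _]]] : exists h' v', [/\ v <= v',
  realizes h' v' (fun d => c d + (1 < d <= n) * l d +
      (d == 1) * \sum_(2 <= i < n.+1 | 0 < l i) (i - 2)) & link h' (v' - 2)].
  by exists h', v'.
elim: n nv Hl0 => [|n IH] nv Hl0.
  exists h, v; split=> //; apply: realizes_ext H _ => d.
  by rewrite big_geq // muln0; lia.
have [|d Hd|h1 [v1 [v1v H1 L1]]] := IH; [lia|by apply: Hl0; lia|].
have [n1|n1] := leqP n.+1 1.
  exists h1, v1; split=> //; apply: realizes_ext H1 _ => d.
  have n2 : n < 2 by lia.
  by rewrite !big_geq // (_ : (1 < d <= n.+1) = (1 < d <= n)) //; lia.
case: (posnP (l n.+1)) => [l0|l0].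
  exists h1, v1; split=> //; apply: realizes_ext H1 _ => d.
  rewrite big_mkcond [in RHS]big_mkcond [in RHS]big_nat_recr //= l0 addn0.
  congr (_ + _ + _); case: (eqVneq d n.+1) => [->|nd]; first by rewrite l0 !muln0.
  congr (nat_of_bool _ * _); lia.
have [|Ol lt] := Hl0 n.+1 _ l0; first lia.
have [|h2 [v2 [v2v H2 L2]]] := add_odd_leftover n1 _ Ol lt H1 L1; first lia.
exists h2, v2; split=> //; first lia.
apply: realizes_ext H2 _ => d.
rewrite big_mkcond [in RHS]big_mkcond [in RHS]big_nat_recr //= l0.
case: (eqVneq d n.+1) => [->|nd]; first lia.
rewrite mulnDr (_ : 1 < d <= n.+1 = (1 < d <= n)); lia.
Qed.

(** * Assembling the path *)

Lemma realizes_of_counts (c : nat -> nat) N s : 1 < N ->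
    (forall d, 0 < c d -> 1 < d <= N) ->
    3 * N - 3 + \sum_(2 <= i < N.+1 | 0 < c i) (i - 2) <= s ->
  exists h v, realizes h v (fun d => c d + (d == 1) * s).
Proof.
move=> N1 cN Hs.
(* Y is the set of lengths entrusted to the spiral, and l d what remains of
   r d: it is zero or odd. *)
pose r d := c d %% d.
pose Y d := (0 < r d) && ~~ odd (r d).
pose l d := r d - Y d.
have [h0 [t [tN H0 L0]]] := spiral_of_distinct_lengths Y N.
(* The widths are one more than the lengths of the walks: the largest odd and
   the largest even number up to N suffice. *)
have [h1 [H1 L1 A1]] := walk_up (N.-1 - ~~ odd N) H0 isT L0.
have [|||h2 [v2 [v12 H2 L2 _]]] := grow_all_periods (p := true) (fun d => c d %/ d) N1 _ H1.
- lia.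
- by [].
- case: (boolP (odd N)) (A1 true) => [oN|/negbTE oN] /= A.
    by apply: alignedW A; lia.
  by apply: alignedS; rewrite ?oN //; apply: alignedW A; lia.
set f := (X in _ + X <= s) in Hs.
pose fl := \sum_(2 <= i < N.+1 | 0 < l i) (i - 2).
have flf : fl <= f.
  rewrite /fl /f big_mkcond [leqRHS]big_mkcond; apply: leq_sum => i _.
  case: ifP => // l0; rewrite ifT //; move: l0; rewrite /l /r.
  by case: (c i) => //; rewrite mod0n.
(* The second walk also absorbs the ones in excess. *)
pose m := s - (t + (N.-1 - ~~ odd N) + fl).
have [|h3 [H3 _ A3]] := walk_up m H2 _ (L2 isT); first lia.
have [|||h4 [v4 [v34 H4 _ A4]]] := grow_all_periods (p := false) (fun d => c d %/ d) N1 _ H3.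
- lia.
- by [].
- have A := A3 false; case: (boolP (odd N)) => [oN|/negbTE oN].
    by apply: alignedS; rewrite ?oN //; apply: alignedW A; rewrite /m oN; lia.
  by apply: alignedW A; rewrite /m oN /=; lia.
have v4N : N < v4 by lia.
have [|d Hd Hl||h5 [v5 H5]] := add_odd_leftovers (l := l) (n := N) _ _ H4.
- lia.
- rewrite /l /Y; have : r d < d by rewrite /r ltn_mod; lia.
  move: Hl; rewrite /l /Y; lia.
- by apply: A4; lia.
exists h5, v5; apply: realizes_ext H5 _ => d.
rewrite -/fl /=; case: (eqVneq d 1) => [->|d1].
  by rewrite /= !mul1n ?mul0n !addn0 !add0n (_ : c 1 = 0); [rewrite /m; lia|have := cN 1; lia].
case: (boolP (1 < d <= N)) => [dN|dN]; last first.
  by rewrite !mul0n; have := cN d; lia.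
have E := divn_eq (c d) d; have : Y d + l d = r d by rewrite /l /Y; lia.
by rewrite /r; case: (odd d) => /=; rewrite ?mul0n ?mul1n; lia.
Qed.

(** As 2d <= v for every length d, the minimum in [edge_length] is d. *)
Lemma realizes_realizable (L : {mset nat}%mset) h v c : realizes h v c ->
    (forall d, c d = L d) -> (forall d, 0 < L d -> 2 * d <= v) -> 0 < v -> realizable L.
Proof.
move=> H Hc Hd v0; have Hs := realizes_size H; case: H => Hp Hn.
have HL : perm_eq (diffs h) L.
  by apply/allP => d _; rewrite /= Hn Hc count_mem_mset.
have Ev : v = (size L).+1.
  rewrite -(perm_size HL) size_map size_zip size_behead Hs; lia.
rewrite /realizable; move: (size L) Ev => n Ev; rewrite {}Ev in Hp Hs Hd v0 *.
have lt x : x \in h -> x < n.+1 by rewrite (perm_mem Hp) mem_iota.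
have Hval : map val (map (@inord n) h) = h.
  by rewrite -map_comp map_id_in // => x /lt Hx; rewrite /= inordK.
exists (map (@inord n) h); split.
  have U : uniq (map (@inord n) h).
    by rewrite -(map_inj_uniq val_inj) Hval (perm_uniq Hp) iota_uniq.
  apply/and3P; split=> //.
    by apply: (pairwise_sorted); rewrite -uniq_pairwise.
  apply/forallP => x; rewrite -(mem_map val_inj) Hval (perm_mem Hp) mem_iota.
  exact: ltn_ord.
apply/msetP => d; rewrite mset_seqE -Hc -Hn.
rewrite -[h in RHS]Hval /diffs edges_map -map_comp; congr (count_mem d _).
apply/eq_in_map => p Hp'; rewrite /edge_length /=.
set e := `|_ - _|; suff : 2 * e <= n.+1 by lia.
apply: Hd; rewrite -Hc -Hn -has_count has_pred1.
rewrite -Hval /diffs edges_map -map_comp; apply/mapP; by exists p.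
Qed.

Theorem theorem1p3 (k : nat) (hk : 1 <= k) (M : {mset nat}%mset)
    (x : nat -> nat)
    (hx1 : 1 < x 1)
    (hx : forall i : nat, 1 <= i < k -> x i < x i.+1)
    (hM : finsupp M = [fset x i | i in iota 1 k]%fset)
    (s : nat)
    (hs : 3 * x k - 5 + \sum_(1 <= i < k.+1) x i <= s) :
  realizable (M `+` msetn s 1)%mset.
Proof.
have mono i j : 1 <= i -> i < j -> j <= k -> x i < x j.
  move=> i1; elim: j => // j IH; rewrite ltnS leq_eqVlt => /orP[/eqP<-|ij] jk.
    by apply: hx; lia.
  by apply: ltn_trans (IH ij _) (hx j _); lia.
have x1 i : 1 <= i <= k -> 1 < x i.
  move=> /andP[i1 ik]; case: (ltnP 1 i) => i2; last by rewrite (_ : i = 1) //; lia.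
  by apply: ltn_trans hx1 _; apply: mono.
have xk i : 1 <= i <= k -> x i <= x k.
  move=> /andP[i1 ik]; case: (ltnP i k) => i2; last by rewrite (_ : i = k) //; lia.
  exact/ltnW/mono.
have inM d : (0 < M d) = (d \in [seq x i | i <- iota 1 k]).
  rewrite lt0n -[_ != 0]/(M d != 0) -mem_finsupp hM.
  apply/imfsetP/mapP => -[i /= Hi ->]; exists i => //.
have supp d : 0 < M d -> 1 < d <= x k.
  by rewrite inM => /mapP[i]; rewrite mem_iota => Hi ->; rewrite x1 ?xk //; lia.
have Hsum : \sum_(2 <= i < (x k).+1 | 0 < M i) (i - 2) + 2 * k = \sum_(1 <= i < k.+1) x i.
  rewrite -big_filter (perm_big [seq x i | i <- iota 1 k]); last first.
    apply: uniq_perm; rewrite ?filter_uniq ?iota_uniq //.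
      rewrite map_inj_in_uniq ?iota_uniq // => i j; rewrite !mem_iota => Hi Hj Hx.
      by case: (ltngtP i j) => // ij; have := mono _ _ _ ij; lia.
    move=> d; rewrite mem_filter mem_index_iota inM.
    by case: (boolP (d \in _)) => //; rewrite -inM => /supp; lia.
  have E : iota 1 k = index_iota 1 k.+1 by rewrite /index_iota subn1.
  rewrite big_map E (_ : 2 * k = \sum_(1 <= i < k.+1) 2); last first.
    by rewrite sum_nat_const_nat; lia.
  rewrite -big_split /= big_nat [RHS]big_nat.
  by apply: eq_bigr => i Hi; have := x1 i; lia.
have xk1 : 1 < x k by apply: x1; lia.
have xkS : x k <= \sum_(1 <= i < k.+1) x i by rewrite big_nat_recr //= leq_addl.
have [||h [v H]] := realizes_of_counts (c := M) (s := s) xk1; [exact: supp|lia|].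
have Hc d : M d + (d == 1) * s = (M `+` msetn s 1)%mset d.
  by rewrite msetE2 msetnE; case: (d == 1); lia.
have vs : s < v.
  have [Hp Hn] := H; have := count_size (pred1 1) (diffs h).
  rewrite Hn eqxx size_map size_zip size_behead (realizes_size H); lia.
apply: (realizes_realizable H Hc); last lia.
move=> d; rewrite -Hc => Hd; suff : d <= x k by lia.
by case: (posnP (M d)) => [Md0|/supp /andP[]//]; lia.
Qed.
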